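(* The mapping $V\mapsto\mathcal{R}_V$ (resp. $V\mapsto\mathcal{L}_V$) establishes a one-to-one correspondence between norm-closed linear subspaces of $\mathbf{C}(\mathfrak{X})$ and cc-closed right (resp. rc-closed left) ideals of $\mathcal{M}$, and also between pc-closed linear subspaces of $\mathbf{C}(\mathfrak{X})$ and pc-closed right (resp. left) ideals of $\mathcal{M}$. In particular, $1$-dimensional subspaces and norm-closed $1$-codimensional subspaces of $\mathbf{C}(\mathfrak{X})$ correspond respectively to minimal and maximal cc-closed right (resp. rc-closed left) ideals of $\mathcal{M}$.
   Context: $\mathfrak{X}$ is a fixed compact metrizable space and $\mathfrak{m}$ is a fixed Borel probability measure on $\mathfrak{X}$ whose support is all of $\mathfrak{X}$. $\mathbf{C}(\mathfrak{X})$ is the Banach space of continuous complex functions on $\mathfrak{X}$ with the supremum norm. $\mathcal{M}=\mathcal{M}_{\mathfrak{X},\mathfrak{m}}$ denotes the Banach $*$-algebra $\mathbf{C}(\mathfrak{X}^2)$ of continuous complex functions on $\mathfrak{X}\times\mathfrak{X}$ with the supremum norm, the multiplication $(f\star g)(x,y)=\int_{\mathfrak{X}}f(x,z)g(z,y)\,d\mathfrak{m}(z)$ and the involution $f^*(x,y)=\overline{f(y,x)}$. For a norm-closed linear subspace $V$ of $\mathbf{C}(\mathfrak{X})$ put $\mathcal{R}_V:=\{f\in\mathcal{M}: f(\cdot,y)\in V\text{ for every }y\in\mathfrak{X}\}$ and $\mathcal{L}_V:=\{f\in\mathcal{M}: f(x,\cdot)\in V\text{ for every }x\in\mathfrak{X}\}$.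 The pointwise convergence topology (pct) on $\mathbf{C}(\mathfrak{X})$ and on $\mathcal{M}=\mathbf{C}(\mathfrak{X}^2)$ is the topology of pointwise convergence of functions. The column-wise convergence topology (cct) on $\mathcal{M}$ is the vector topology in which $f_\lambda\to f$ iff $\sup_{x}|f_\lambda(x,y)-f(x,y)|\to0$ for every $y\in\mathfrak{X}$; the row-wise convergence topology (rct) is the vector topology in which $f_\lambda\to f$ iff $\sup_{y}|f_\lambda(x,y)-f(x,y)|\to0$ for every $x\in\mathfrak{X}$. The terms pc-closed, cc-closed, rc-closed mean closed in the pct, cct, rct respectively. Minimal (resp. maximal) cc-closed right ideals are the minimal elements among nonzero (resp. maximal elements among proper) cc-closed right ideals, ordered by inclusion; similarly for rc-closed left ideals. *)

(* Defs.v *)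
From HB Require Import structures.
From mathcomp Require Import all_boot all_order all_algebra.
From mathcomp Require Import complex ring lra.
From mathcomp Require Import all_classical all_reals all_analysis.

Set Implicit Arguments.
Unset Strict Implicit.
Unset Printing Implicit Defensive.

Import Order.TTheory GRing.Theory Num.Theory.
Import numFieldNormedType.Exports.

Local Open Scope classical_set_scope.
Local Open Scope ring_scope.

(* The topology and the normed-module structure of R[i] come from its norm. *)
HB.instance Definition _ (R : rcfType) := PseudoPointedMetric.copy R[i] R[i]^o.
HB.instance Definition _ (R : rcfType) := GRing.ComAlgebra.copy R[i] R[i]^o.
HB.instance Definition _ (R : rcfType) := NormedModule.copy R[i] R[i]^o.

Section continuous_module.
Context (K : numFieldType) (V : normedModType K) (Z : topologicalType).
Implicit Types f g h : continuousType Z V.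

Lemma cts_zero_subproof : continuous (fun _ : Z => 0 : V).
Proof. by move=> z; exact: cvg_cst. Qed.

Lemma cts_add_subproof f g : continuous (fun z => f z + g z).
Proof. by move=> z; apply: cvgD; exact: cts_fun. Qed.

Lemma cts_opp_subproof f : continuous (fun z => - f z).
Proof. by move=> z; apply: cvgN; exact: cts_fun. Qed.

Lemma cts_scale_subproof (a : K) f : continuous (fun z => a *: f z).
Proof. by move=> z; apply: cvgZ; [exact: cvg_cst|exact: cts_fun]. Qed.

Definition cts_zero : continuousType Z V := mkcts cts_zero_subproof.
Definition cts_add f g : continuousType Z V := mkcts (@cts_add_subproof f g).
Definition cts_opp f : continuousType Z V := mkcts (@cts_opp_subproof f).
Definition cts_scale a f : continuousType Z V :=
  mkcts (@cts_scale_subproof a f).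

Lemma cts_addA : associative cts_add.
Proof. by move=> f g h; apply/continuousEP => z /=; exact: addrA. Qed.
Lemma cts_addC : commutative cts_add.
Proof. by move=> f g; apply/continuousEP => z /=; exact: addrC. Qed.
Lemma cts_add0 : left_id cts_zero cts_add.
Proof. by move=> f; apply/continuousEP => z /=; exact: add0r. Qed.
Lemma cts_addN : left_inverse cts_zero cts_opp cts_add.
Proof. by move=> f; apply/continuousEP => z /=; exact: addNr. Qed.

HB.instance Definition _ := GRing.isZmodule.Build (continuousType Z V)
  cts_addA cts_addC cts_add0 cts_addN.

Lemma cts_scaleA a b f : cts_scale a (cts_scale b f) = cts_scale (a * b) f.
Proof. by apply/continuousEP => z /=; exact: scalerA. Qed.
Lemma cts_scale1 : left_id 1 cts_scale.
Proof. by move=> f; apply/continuousEP => z /=; exact: scale1r. Qed.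
Lemma cts_scaleDr : right_distributive cts_scale +%R.
Proof. by move=> a f g; apply/continuousEP => z /=; exact: scalerDr. Qed.
Lemma cts_scaleDl f : {morph cts_scale^~ f : a b / a + b}.
Proof. by move=> a b; apply/continuousEP => z /=; exact: scalerDl. Qed.

HB.instance Definition _ := GRing.Zmodule_isLmodule.Build K
  (continuousType Z V) cts_scaleA cts_scale1 cts_scaleDr cts_scaleDl.

End continuous_module.

Notation Cfun R Z := (continuousType Z%type (complex R)).

Notation Mfun R X := (Cfun R (X * X)).

Definition metrizable (R : realType) (X : topologicalType) : Prop :=
  exists d : X -> X -> R,
    [/\ forall x y, d x y = 0 <-> x = y,
        forall x y, d x y = d y x,
        forall x y z, d x z <= d x y + d y z &
        forall x (A : set X),
          nbhs x A <-> exists2 e, 0 < e & [set y | d x y < e] `<=` A].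

(* The Borel sigma-algebra; g_sigma_algebraType needs a pointed carrier, which
   is harmless as a space carrying a probability measure is nonempty. *)
Notation borel X := (g_sigma_algebraType (@open X)).

Definition measure_support (R : realType) (X : ptopologicalType)
    (m : probability (borel X) R) : set X :=
  [set x | forall U : set X, open_nbhs x U -> (0 < m U)%E].

Definition cintegral (R : realType) (X : ptopologicalType)
    (m : probability (borel X) R) (u : X -> R[i]) : R[i] :=
  Complex (\int[m]_z complex.Re (u z)) (\int[m]_z complex.Im (u z)).

Section sections.
Context (R : realType) (X : topologicalType).
Implicit Types f : Mfun R X.

Lemma pairl_continuous (y : X) : continuous (fun x : X => (x, y)).
Proof. by move=> x; apply: cvg_pair; [exact: cvg_id|exact: cvg_cst]. Qed.

Lemma pairr_continuous (x : X) : continuous (fun y : X => (x, y)).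
Proof. by move=> y; apply: cvg_pair; [exact: cvg_cst|exact: cvg_id]. Qed.

Lemma col_subproof f (y : X) : continuous (fun x : X => f (x, y)).
Proof.
move=> x; apply: (@continuous_comp _ _ _ (fun x : X => (x, y)) f).
  exact: pairl_continuous.
exact: cts_fun.
Qed.

Lemma row_subproof f (x : X) : continuous (fun y : X => f (x, y)).
Proof.
move=> y; apply: (@continuous_comp _ _ _ (fun y : X => (x, y)) f).
  exact: pairr_continuous.
exact: cts_fun.
Qed.

Definition fcol f (y : X) : Cfun R X := mkcts (@col_subproof f y).
Definition frow f (x : X) : Cfun R X := mkcts (@row_subproof f x).

(* [R_ideal V] and [L_ideal V] are the sets written R_V and L_V; they are
   one-sided ideals only for suitable [V]. *)
Definition R_ideal (V : set (Cfun R X)) : set (Mfun R X) :=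
  [set f | forall y, V (fcol f y)].

Definition L_ideal (V : set (Cfun R X)) : set (Mfun R X) :=
  [set f | forall x, V (frow f x)].

End sections.

Section star_product.
Context (R : realType) (X : ptopologicalType) (cX : compact [set: X]).
Context (m : probability (borel X) R).

Lemma Re_continuous : continuous (@complex.Re R : R[i] -> R).
Proof.
move=> z; apply/(cvgrPdist_lt (FF := nbhs_filter z)) => e e0.
have e0' : 0 < e%:C%C :> R[i] by rewrite ltcR.
apply: filterS (nbhsx_ballx z _ e0') => t.
rewrite -ball_normE /= -ltcR; apply: le_lt_trans.
case: z t => a b [c d]; rewrite normc_def /= lecR.
by rewrite -sqrtr_sqr ler_wsqrtr// lerDl sqr_ge0.
Qed.

Lemma Im_continuous : continuous (@complex.Im R : R[i] -> R).
Proof.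
move=> z; apply/(cvgrPdist_lt (FF := nbhs_filter z)) => e e0.
have e0' : 0 < e%:C%C :> R[i] by rewrite ltcR.
apply: filterS (nbhsx_ballx z _ e0') => t.
rewrite -ball_normE /= -ltcR; apply: le_lt_trans.
case: z t => a b [c d]; rewrite normc_def /= lecR.
by rewrite -sqrtr_sqr ler_wsqrtr// lerDr sqr_ge0.
Qed.

Lemma Complex_continuous (Z : topologicalType) (u v : Z -> R) :
  continuous u -> continuous v ->
  continuous (fun z => Complex (u z) (v z) : R[i]).
Proof.
move=> cu cv z; apply/cvgrPdist_lt => -[e e']; rewrite ltcE /=.
move=> /andP[/eqP -> e0].
have e20 : 0 < e / 2 by rewrite divr_gt0.
have /cvgrPdist_lt /(_ _ e20) Hu := cu z.
have /cvgrPdist_lt /(_ _ e20) Hv := cv z.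
near=> t.
have hu : `|u z - u t| < e / 2 by near: t.
have hv : `|v z - v t| < e / 2 by near: t.
rewrite normc_def -[Complex e 0]/(e%:C%C) ltcR /=.
rewrite -[ltRHS](gtr0_norm e0) -sqrtr_sqr ltr_sqrt ?exprn_gt0//.
rewrite -(real_normK (num_real (u z - _))) -(real_normK (num_real (v z - _))).
have := normr_ge0 (u z - u t); have := normr_ge0 (v z - v t).
move: hu hv; move: `|_| `|_| => a b; nra.
Unshelve. all: by end_near. Qed.

Lemma continuous_integrable (u : X -> R) : continuous u ->
  m.-integrable setT (EFin \o u).
Proof.
move=> cu; apply: (@measurable_bounded_integrable _ (borel X)) => //.
- exact: fin_num_fun_lty.
- apply: (measurability _ (measurable_realfun.RGenOpens.measurableE R)).
  move=> _ [_ [a [b ->] <-]]; rewrite setTI; apply: sub_sigma_algebra.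
  by move/continuousP : cu; apply; exact: interval_open.
- have cu' : {within [set: X], continuous u} by exact: continuous_subspaceT.
  have /compact_bounded[M [_ Mu]] := continuous_compact cu' cX.
  by exists M; split; rewrite ?num_real// => t Mt x _; apply: Mu => //; exists x.
Qed.

Lemma parametric_continuous (P : topologicalType) (F : P -> X -> R) :
  continuous (fun pz : P * X => F pz.1 pz.2) ->
  continuous (fun p => \int[m]_z F p z).
Proof.
move=> cF.
have cFp p : continuous (F p).
  move=> z; apply: (@continuous_comp _ _ _ (fun z => (p, z))
    (fun pz : P * X => F pz.1 pz.2)).
    by apply: cvg_pair; [exact: cvg_cst|exact: cvg_id].
  exact: cF.
move=> p; apply/cvgrPdist_le => e e0.
have e20 : 0 < e / 2 by rewrite divr_gt0.
have /compact_near_coveringP nX := cX.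
have {}nX : \forall q \near p, [set: X] `<=` (fun z => `|F p z - F q z| <= e).
  apply: (nX _ _ (fun q z => `|F p z - F q z| <= e)) => z _.
  have /cvgrPdist_lt /(_ _ e20) H := cF (p, z).
  have /cvgrPdist_lt /(_ _ e20) H' := cFp p z.
  case: H => -[A B] /= [pA zB] AB.
  exists (B `&` [set t | `|F p z - F p t| < e / 2], A) => /=.
    by split=> //; exact: filterI.
  move=> [t q] /= [[Bt pt] Aq].
  have := AB (q, t) (conj Aq Bt) => /= qt.
  have -> : F p t - F q t = (F p z - F q t) - (F p z - F p t) by ring.
  by rewrite (le_trans (ler_normB _ _))// (splitr e) lerD// ltW.
near=> q.
have hq : forall z, `|F p z - F q z| <= e.
  by move=> z; move: z (I : [set: X] z); near: q.
have ip := continuous_integrable (cFp p).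
have iq := continuous_integrable (cFp q).
rewrite -RintegralB//.
have cpq : continuous (fun z => F p z - F q z).
  by move=> z; apply: cvgB; exact: cFp.
have ipq := continuous_integrable cpq.
rewrite (le_trans (le_normr_Rintegral _ ipq))//.
have -> : e = \int[m]_(z in [set: borel X]) cst e z.
  rewrite Rintegral_cst// [Y in fine Y](_ : _ = 1%E) ?mulr1//.
  exact: probability_setT.
apply: le_Rintegral => //.
- by apply: continuous_integrable => z; apply: cvg_norm; exact: cpq.
- by apply: continuous_integrable => z; exact: cvg_cst.

Unshelve. all: by end_near. Qed.

Lemma cintegral_continuous (P : topologicalType) (F : P -> X -> R[i]) :
  continuous (fun pz : P * X => F pz.1 pz.2) ->
  continuous (fun p => cintegral m (F p)).
Proof.
move=> cF; apply: Complex_continuous; apply: parametric_continuous => pz.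
- apply: (@continuous_comp _ _ _ (fun pz : P * X => F pz.1 pz.2)).
    exact: cF.
  exact: Re_continuous.
- apply: (@continuous_comp _ _ _ (fun pz : P * X => F pz.1 pz.2)).
    exact: cF.
  exact: Im_continuous.
Qed.

Lemma star_subproof (f g : Mfun R X) : continuous (fun p : X * X =>
  cintegral m (fun z => f (p.1, z) * g (z, p.2))).
Proof.
apply: cintegral_continuous => -[[x y] z] /=.
have c1 : (fun q : (X * X) * X => (q.1.1, q.2)) @ (x, y, z) --> (x, z).
  apply: cvg_pair; last exact: cvg_snd.
  by apply: (@cvg_comp _ _ _ fst fst); [exact: cvg_fst|exact: cvg_fst].
have c2 : (fun q : (X * X) * X => (q.2, q.1.2)) @ (x, y, z) --> (z, y).
  apply: cvg_pair; first exact: cvg_snd.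
  by apply: (@cvg_comp _ _ _ fst snd); [exact: cvg_fst|exact: cvg_snd].
apply: (@cvgM _ _ _ _ (fun q : X * X * X => f (q.1.1, q.2))
  (fun q : X * X * X => g (q.2, q.1.2))).
- exact: (cvg_comp _ _ c1 (@cts_fun _ _ f (x, z))).
- exact: (cvg_comp _ _ c2 (@cts_fun _ _ g (z, y))).
Qed.

Definition star (f g : Mfun R X) : Mfun R X := mkcts (@star_subproof f g).

End star_product.

Section topologies.
Context (R : realType).

(* Each topology is induced from a topology on a space of all functions, so
   closed sets are relatively closed among continuous functions; the lemmas
   cvg_norm_topology, cvg_pct, cvg_cct and cvg_rct describe convergence. *)
Definition norm_topology (Z : topologicalType) : topologicalType :=
  initial_topology (id : Cfun R Z -> {uniform Z -> R[i]}).

Definition pct (Z : topologicalType) : topologicalType :=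
  initial_topology (id : Cfun R Z -> {ptws Z -> R[i]}).

Definition cct (X : topologicalType) : topologicalType :=
  initial_topology ((fun f y x => f (x, y)) :
    Mfun R X -> {ptws X -> {uniform X -> R[i]}}).

Definition rct (X : topologicalType) : topologicalType :=
  initial_topology ((fun f x y => f (x, y)) :
    Mfun R X -> {ptws X -> {uniform X -> R[i]}}).

Lemma cvg_initial (S : choiceType) (T : topologicalType) (h : S -> T)
    (F : set_system S) (s : S) : Filter F ->
  F --> (s : initial_topology h) <-> h @ F --> h s.
Proof.
move=> FF; split=> [Fs A nA|hFs A [_ [[B oB <-] Bs] BA]].
  by apply: Fs; exact: (@initial_continuous S T h s A nA).
by apply: filterS BA _; apply: hFs; exact: open_nbhs_nbhs.
Qed.

Lemma cvg_ptws (I : Type) (T : topologicalType) (F : set_system (I -> T))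
    (h : I -> T) : Filter F ->
  F --> (h : {ptws I -> T}) <-> forall i, g i @[g --> F] --> h i.
Proof.
move=> FF; rewrite cvg_sup; split=> Fh i.
  by have /cvg_initial := Fh i; exact.
by apply/cvg_initial; exact: Fh.
Qed.

Lemma cvg_uniform (Z : choiceType) (F : set_system (Z -> R[i]))
    (h : Z -> R[i]) : Filter F ->
  F --> (h : {uniform Z -> R[i]}) <->
  forall e : R, 0 < e -> \forall g \near F, forall z, `|h z - g z| < e%:C%C.
Proof.
move=> FF; split=> [Fh e e0|Fh A /uniform_nbhs [E [entE EA]]].
  apply: Fh; apply/uniform_nbhs.
  exists [set xy : R[i] * R[i] | ball xy.1 e%:C%C xy.2]; split.
    by rewrite -entourage_ballE; exists e%:C%C => //=; rewrite ltcR.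
  by move=> g /= hg z; have := hg z I; rewrite -ball_normE.
have [e e0 eE] : exists2 e : R, 0 < e &
    [set xy : R[i] * R[i] | `|xy.1 - xy.2| < e%:C%C] `<=` E.
  move: entE; rewrite -entourage_ballE => -[[e e'] /=].
  rewrite ltcE /= => /andP[/eqP -> e0] eE; exists e => //.
apply: filterS EA _; apply: filterS (Fh _ e0) => g hg z _.
exact: (eE (h z, g z) (hg z)).
Qed.

Lemma cvg_norm_topology (Z : topologicalType) (F : set_system (Cfun R Z))
    (f : Cfun R Z) : Filter F ->
  F --> (f : norm_topology Z) <->
  forall e : R, 0 < e ->
    F [set g : Cfun R Z | forall z, `|f z - g z| < e%:C%C].
Proof. by move=> FF; rewrite cvg_initial; exact: cvg_uniform. Qed.

Lemma cvg_pct (Z : topologicalType) (F : set_system (Cfun R Z))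
    (f : Cfun R Z) : Filter F ->
  F --> (f : pct Z) <-> forall z, (fun g : Cfun R Z => g z) @ F --> f z.
Proof. by move=> FF; rewrite cvg_initial; exact: cvg_ptws. Qed.

Lemma cvg_cct (X : topologicalType) (F : set_system (Mfun R X))
    (f : Mfun R X) : Filter F ->
  F --> (f : cct X) <->
  forall y (e : R), 0 < e ->
    F [set g : Mfun R X | forall x, `|f (x, y) - g (x, y)| < e%:C%C].
Proof.
move=> FF; rewrite cvg_initial cvg_ptws.
split=> H z; last by apply/cvg_uniform; exact: H.
by move=> e e0; exact: ((cvg_uniform _ _).1 (H z) e e0).
Qed.

Lemma cvg_rct (X : topologicalType) (F : set_system (Mfun R X))
    (f : Mfun R X) : Filter F ->
  F --> (f : rct X) <->
  forall x (e : R), 0 < e ->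
    F [set g : Mfun R X | forall y, `|f (x, y) - g (x, y)| < e%:C%C].
Proof.
move=> FF; rewrite cvg_initial cvg_ptws.
split=> H z; last by apply/cvg_uniform; exact: H.
by move=> e e0; exact: ((cvg_uniform _ _).1 (H z) e e0).
Qed.

End topologies.

Section subspaces.
Context (K : numFieldType) (E : lmodType K).
Implicit Types V : set E.

Definition linear_subspace V : Prop :=
  V 0 /\ forall (a : K) u v, V u -> V v -> V (a *: u + v).

Definition one_dimensional V : Prop :=
  exists2 v, v != 0 & V = [set a *: v | a in [set: K]].

(* The quotient E / V is spanned by the nonzero class of w. *)
Definition one_codimensional V : Prop :=
  linear_subspace V /\
  exists2 w, ~ V w & forall u, exists a : K, V (u - a *: w).

End subspaces.

Definition norm_closed_subspace (R : realType) (X : topologicalType)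
    (V : set (Cfun R X)) : Prop :=
  linear_subspace V /\ closed (V : set (norm_topology R X)).

Definition pc_closed_subspace (R : realType) (X : topologicalType)
    (V : set (Cfun R X)) : Prop :=
  linear_subspace V /\ closed (V : set (pct R X)).

Section ideals.
Context (R : realType) (X : ptopologicalType) (cX : compact [set: X]).
Context (m : probability (borel X) R).
Implicit Types I : set (Mfun R X).

(* Ideals of the (possibly non-unital) complex algebra: linear subspaces. *)
Definition right_ideal I : Prop :=
  linear_subspace I /\ forall f g, I f -> I (star cX m f g).

Definition left_ideal I : Prop :=
  linear_subspace I /\ forall f g, I f -> I (star cX m g f).

Definition cc_closed_right_ideal I : Prop :=
  right_ideal I /\ closed (I : set (cct R X)).

Definition rc_closed_left_ideal I : Prop :=
  left_ideal I /\ closed (I : set (rct R X)).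

Definition pc_closed_right_ideal I : Prop :=
  right_ideal I /\ closed (I : set (pct R (X * X)%type)).

Definition pc_closed_left_ideal I : Prop :=
  left_ideal I /\ closed (I : set (pct R (X * X)%type)).

End ideals.

Definition minimal_nonzero (E : zmodType) (P : set E -> Prop) (I : set E) :=
  [/\ P I, I <> [set 0] &
      forall J, P J -> J <> [set 0] -> J `<=` I -> J = I].

Definition maximal_proper (E : Type) (P : set E -> Prop) (I : set E) :=
  [/\ P I, I <> [set: E] &
      forall J, P J -> J <> [set: E] -> I `<=` J -> J = I].

(* Main.v *)
(* A function f in M is uniformly approximated by finite sums of
   f(., y_i) (x) h_i, where the h_i form a partition of unity on X. Hence R_V is
   a right ideal for every norm-closed V. Conversely, for a cc-closed right
   ideal I put V := {v | v (x) 1 in I}. Multiplying f in I on the right by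
   k (x) 1, with k a bump of integral 1 concentrated near y (it exists because m
   has full support), approximates f(., y) (x) 1, so the columns of f are in V;
   and v (x) h = (v (x) 1) * (1 (x) h) is in I for v in V, so the approximation
   above gives R_V = I. Transposition exchanges right and left ideals. As
   V |-> R_V is an order isomorphism, minimal and maximal ideals come from
   minimal and maximal closed subspaces, which are the lines and the closed
   hyperplanes because V + C w is closed when V is. *)
Require Import Defs.
From HB Require Import structures.
From mathcomp Require Import all_boot all_order all_algebra.
From mathcomp Require Import complex ring lra.
From mathcomp Require Import all_classical all_reals all_analysis.

Set Implicit Arguments.
Unset Strict Implicit.
Unset Printing Implicit Defensive.

Import Order.TTheory GRing.Theory Num.Theory.
Import numFieldNormedType.Exports.

Local Open Scope classical_set_scope.
Local Open Scope ring_scope.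

(** * Bounds between a complex number and its real and imaginary parts *)

Section complex_numbers.
Context (R : realType).
Implicit Types (z : R[i]) (a b : R).

Lemma normc_le_ReIm z b :
  `|z| <= b%:C%C -> `|complex.Re z| <= b /\ `|complex.Im z| <= b.
Proof.
move=> zb; rewrite -!lecR; split; apply: le_trans zb.
  exact: normc_ge_Re.
by case: z => x y; rewrite normc_def lecR -sqrtr_sqr ler_wsqrtr// lerDr sqr_ge0.
Qed.

Lemma normcMr_real z b : 0 <= b -> `|z * b%:C%C| = `|z| * b%:C%C.
Proof. by move=> b0; rewrite normrM [X in _ * X]ger0_norm// lecR. Qed.

(** The constant 2 stands for the optimal square root of 2; later estimates absorb it in their
    choice of tolerances. *)
Lemma normc_ReIm_le z b : `|complex.Re z| <= b -> `|complex.Im z| <= b ->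
  `|z| <= (2 * b)%:C%C.
Proof.
case: z => x y /= xb yb; have b0 : 0 <= b by exact: le_trans xb.
rewrite normc_def lecR /= -[leRHS]ger0_norm ?mulr_ge0// -sqrtr_sqr ler_wsqrtr//.
rewrite -(real_normK (num_real x)) -(real_normK (num_real y)).
have := normr_ge0 x; have := normr_ge0 y.
move: xb yb; move: `|x| `|y| => s t; nra.
Qed.

End complex_numbers.

(** * Comparison of the norm, pointwise and column-wise topologies *)

Section topology.
Context (R : realType).

(* A set closed in any of the topologies considered here contains its uniform
   limits; this is all that most of the arguments use of closedness. *)
Definition unif_closed (Z : topologicalType) (A : set (Cfun R Z)) : Prop :=
  forall f : Cfun R Z, (forall e : R, 0 < e ->
    exists2 g, A g & forall z, `|f z - g z| <= e%:C%C) -> A f.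

Lemma nbhs_norm (Z : topologicalType) (f : Cfun R Z) (e : R) : 0 < e ->
  nbhs (f : norm_topology R Z)
    [set g : Cfun R Z | forall z, `|f z - g z| < e%:C%C].
Proof.
move: e; have FF : Filter (nbhs (f : norm_topology R Z)) := nbhs_filter _.
exact: (proj1 (cvg_norm_topology f FF) cvg_id).
Qed.

Lemma nbhs_cct (X : topologicalType) (f : Mfun R X) (y : X) (e : R) : 0 < e ->
  nbhs (f : cct R X)
    [set g : Mfun R X | forall x, `|f (x, y) - g (x, y)| < e%:C%C].
Proof.
move: y e; have FF : Filter (nbhs (f : cct R X)) := nbhs_filter _.
exact: (proj1 (cvg_cct f FF) cvg_id).
Qed.

(** Reduces norm-closedness to estimates with a weak inequality, the form in which approximants are
    produced below. *)
Lemma norm_closedP (Z : topologicalType) (A : set (Cfun R Z)) :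
  closed (A : set (norm_topology R Z)) <-> unif_closed A.
Proof.
split=> [cA f fA|uA f clAf].
- apply: cA => B; rewrite nbhsE /= => -[_ [[C oC <-] Cf] CB].
  have FF : Filter (nbhs (f : norm_topology R Z)) by exact: nbhs_filter.
  have [E [entE EC]] : exists E, entourage E /\
      [set g | forall z, [set: Z] z -> E (f z, g z)] `<=` C.
    by apply/uniform_nbhs; exact: open_nbhs_nbhs.
  move: entE; rewrite -entourage_ballE => -[[e e'] /=].
  rewrite ltcE /= => /andP[/eqP -> e0] eE.
  (* Halving [e] turns the weak bound on [g] into the strict one that the entourage asks for. *)
  have e20 : 0 < e / 2 by rewrite divr_gt0.
  have [g Ag fg] := fA _ e20.
  exists g; split => //; apply: CB; apply: EC => z _; apply: eE => /=.
  rewrite -ball_normE /=; apply: (le_lt_trans (fg z)).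
  by rewrite ltcR ltr_pdivrMr// ltr_pMr// ltr1n.
- apply: uA => e e0.
  have [|g [Ag gf]] :=
      clAf [set g : Cfun R Z | forall z, `|f z - g z| < e%:C%C].
    exact: nbhs_norm.
  by exists g => // z; exact: ltW.
Qed.

(** First of three comparisons: the pct is coarser than the norm topology and the cct, and the cct
    is coarser than the norm topology. Closed sets then pull back along the identity to the finer
    topology. *)
Lemma continuous_pct_norm (Z : topologicalType) :
  continuous (id : norm_topology R Z -> pct R Z).
Proof.
move=> f; apply/(cvg_pct _ (fmap_filter _ (nbhs_filter _))) => z.
apply/cvgrPdist_lt => -[e e'].
rewrite ltcE /= => /andP[/eqP -> e0].
by apply: filterS (nbhs_norm f e0) => g /(_ z).
Qed.

Lemma continuous_pct_cct (X : topologicalType) :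
  continuous (id : cct R X -> pct R (X * X)%type).
Proof.
move=> f; apply/(cvg_pct _ (fmap_filter _ (nbhs_filter _))) => -[x y].
apply/cvgrPdist_lt => -[e e'].
rewrite ltcE /= => /andP[/eqP -> e0].
by apply: filterS (nbhs_cct f y e0) => g /(_ x).
Qed.

Lemma continuous_cct_norm (X : topologicalType) :
  continuous (id : norm_topology R (X * X)%type -> cct R X).
Proof.
move=> f; apply/(cvg_cct _ (fmap_filter _ (nbhs_filter _))) => y e e0.
by apply: filterS (nbhs_norm f e0) => g gf x; exact: gf.
Qed.

Lemma pct_closed_norm (Z : topologicalType) (A : set (Cfun R Z)) :
  closed (A : set (pct R Z)) -> closed (A : set (norm_topology R Z)).
Proof.
apply: (@preimage_closed (norm_topology R Z) (pct R Z) id) => f _.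
exact: continuous_pct_norm.
Qed.

Lemma pct_closed_cct (X : topologicalType) (A : set (Mfun R X)) :
  closed (A : set (pct R (X * X)%type)) -> closed (A : set (cct R X)).
Proof.
apply: (@preimage_closed (cct R X) (pct R (X * X)%type) id) => f _.
exact: continuous_pct_cct.
Qed.

Lemma cct_closed_unif (X : topologicalType) (A : set (Mfun R X)) :
  closed (A : set (cct R X)) -> unif_closed A.
Proof.
move=> cA; apply/norm_closedP.
apply: (@preimage_closed (norm_topology R (X * X)%type) (cct R X) id) => //.
move=> f _; exact: continuous_cct_norm.
Qed.

Lemma continuous_fcol_cct (X : topologicalType) (y : X) :
  continuous ((@fcol R X)^~ y : cct R X -> norm_topology R X).
Proof.
move=> f; apply/(cvg_norm_topology _ (fmap_filter _ (nbhs_filter _))) => e e0.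
exact: nbhs_cct.
Qed.

Lemma continuous_fcol_pct (X : topologicalType) (y : X) :
  continuous ((@fcol R X)^~ y : pct R (X * X)%type -> pct R X).
Proof.
move=> f; apply/(cvg_pct _ (fmap_filter _ (nbhs_filter _))) => x.
have FF : Filter (nbhs (f : pct R (X * X)%type)) := nbhs_filter _.
exact: (proj1 (cvg_pct f FF) cvg_id (x, y)).
Qed.

(** [R_ideal V] is the intersection of the preimages of [V] under the column maps, each continuous
    from the cct to the norm topology. *)
Lemma R_ideal_closed_cct (X : topologicalType) (V : set (Cfun R X)) :
  closed (V : set (norm_topology R X)) ->
  closed (R_ideal V : set (cct R X)).
Proof.
move=> cV; rewrite [R_ideal V](_ : _ = \bigcap_y ((@fcol R X)^~ y @^-1` V)).
  apply: closed_bigI => y _; apply: preimage_closed cV => f _.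
  exact: continuous_fcol_cct.
by apply/seteqP; split=> f Vf y; [move=> _; exact: Vf|exact: Vf].
Qed.

Lemma R_ideal_closed_pct (X : topologicalType) (V : set (Cfun R X)) :
  closed (V : set (pct R X)) ->
  closed (R_ideal V : set (pct R (X * X)%type)).
Proof.
move=> cV; rewrite [R_ideal V](_ : _ = \bigcap_y ((@fcol R X)^~ y @^-1` V)).
  apply: closed_bigI => y _; apply: preimage_closed cV => f _.
  exact: continuous_fcol_pct.
by apply/seteqP; split=> f Vf y; [move=> _; exact: Vf|exact: Vf].
Qed.

End topology.

(** * Linearity and estimates for the complex integral *)

Section cintegral.
Context (R : realType) (X : ptopologicalType) (cX : compact [set: X]).
Context (m : probability (borel X) R).
Implicit Types u v : X -> R[i].

Let intg (f : X -> R) : continuous f -> m.-integrable setT (EFin \o f).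
Proof. exact: continuous_integrable. Qed.

Lemma continuous_Re u : continuous u -> continuous (fun z => complex.Re (u z)).
Proof.
move=> cu z; apply: (@continuous_comp _ _ _ u); first exact: cu.
exact: Re_continuous.
Qed.

Lemma continuous_Im u : continuous u -> continuous (fun z => complex.Im (u z)).
Proof.
move=> cu z; apply: (@continuous_comp _ _ _ u); first exact: cu.
exact: Im_continuous.
Qed.

Let intR u : continuous u ->
  m.-integrable setT (EFin \o (fun z => complex.Re (u z))).
Proof. by move=> cu; apply: intg; exact: continuous_Re. Qed.

Let intI u : continuous u ->
  m.-integrable setT (EFin \o (fun z => complex.Im (u z))).
Proof. by move=> cu; apply: intg; exact: continuous_Im. Qed.

Lemma cintegralD u v : continuous u -> continuous v ->
  cintegral m (fun z => u z + v z) = cintegral m u + cintegral m v.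
Proof.
move=> cu cv; rewrite /cintegral.
under eq_Rintegral do rewrite raddfD.
rewrite RintegralD//; [|exact: intR|exact: intR].
under [X in Complex _ X = _]eq_Rintegral do rewrite raddfD.
by rewrite RintegralD//; [exact: intI|exact: intI].
Qed.

Lemma cintegralZ (c : R[i]) u : continuous u ->
  cintegral m (fun z => c * u z) = c * cintegral m u.
Proof.
case: c => a b cu; rewrite /cintegral.
have Zi (t : R) (f : X -> R) : continuous f ->
    m.-integrable setT (EFin \o (fun z => t * f z)).
  by move=> cf; apply: intg => z; apply: cvgM; [exact: cvg_cst|exact: cf].
have RE : (fun z => complex.Re (Complex a b * u z)) =
    (fun z => a * complex.Re (u z) - b * complex.Im (u z)).
  by apply/funext => z; case: (u z).
have IE : (fun z => complex.Im (Complex a b * u z)) =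
    (fun z => a * complex.Im (u z) + b * complex.Re (u z)).
  by apply/funext => z; case: (u z).
rewrite RE IE RintegralB//; last 2 first.
- by apply: Zi; exact: continuous_Re.
- by apply: Zi; exact: continuous_Im.
rewrite RintegralD//; last 2 first.
- by apply: Zi; exact: continuous_Im.
- by apply: Zi; exact: continuous_Re.
rewrite !RintegralZl//; [exact: intR|exact: intI|exact: intI|exact: intR].
Qed.

Lemma cintegral_cst (c : R[i]) : cintegral m (fun=> c) = c.
Proof.
rewrite /cintegral !Rintegral_cst// (_ : fine (m _) = 1) ?mulr1.
  by case: c.
by rewrite [X in fine X](_ : _ = 1%E)//; exact: probability_setT.
Qed.

Lemma cintegral_realC (k : X -> R) : continuous k ->
  cintegral m (fun z => (k z)%:C%C) = (\int[m]_z k z)%:C%C.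
Proof. by move=> ck; rewrite /cintegral /= Rintegral_cst// mul0r. Qed.

(** The bound [b] varies with the point so that a small oscillation can be weighted by a bump
    function. Real and imaginary parts are bounded separately, whence the factor 2. *)
Lemma normc_cintegral_le u (b : X -> R) : continuous u -> continuous b ->
  (forall z, `|u z| <= (b z)%:C%C) ->
  `|cintegral m u| <= (2 * \int[m]_z b z)%:C%C.
Proof.
move=> cu cb ub.
have cR := continuous_Re cu; have cI := continuous_Im cu.
apply: normc_ReIm_le => /=; (apply: le_trans;
    first by apply: le_normr_Rintegral; rewrite //; apply: intg);
  apply: le_Rintegral => //; (try exact: intg);
  [|by move=> z _; have [] := normc_le_ReIm (ub z)| |
    by move=> z _; have [] := normc_le_ReIm (ub z)].
- by apply: intg => z; apply: cvg_norm; exact: cR.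
- by apply: intg => z; apply: cvg_norm; exact: cI.
Qed.

End cintegral.

Lemma ctsDE (R : realType) (Z : topologicalType) (f g : Cfun R Z) z :
  (f + g) z = f z + g z.
Proof. by []. Qed.

(** * Elementary tensors *)

Section tensors.
Context (R : realType) (X : topologicalType).
Implicit Types (v h : Cfun R X) (f : Mfun R X).

Lemma tens_subproof v h : continuous (fun p : X * X => v p.1 * h p.2).
Proof.
move=> p; apply: cvgM.
  by apply: (@continuous_comp _ _ _ fst v); [exact: cvg_fst|exact: cts_fun].
by apply: (@continuous_comp _ _ _ snd h); [exact: cvg_snd|exact: cts_fun].
Qed.

Definition tens v h : Mfun R X := mkcts (@tens_subproof v h).

Lemma tensE v h p : tens v h p = v p.1 * h p.2.
Proof. by []. Qed.

Lemma one_subproof : continuous (fun _ : X => 1 : R[i]).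
Proof. by move=> x; exact: cvg_cst. Qed.

Definition cts_one : Cfun R X := mkcts one_subproof.

Lemma fcol_tens v h y : fcol (tens v h) y = h y *: v.
Proof. by apply/continuousEP => x /=; exact: mulrC. Qed.

Lemma fcol_tens1 v y : fcol (tens v cts_one) y = v.
Proof. by rewrite fcol_tens scale1r. Qed.

(** Makes the set of [v] with [tens v cts_one] in a given cc-closed set norm-closed, as a
    preimage. *)
Lemma continuous_tens1_cct :
  continuous (tens^~ cts_one : norm_topology R X -> cct R X).
Proof.
move=> v; apply/(cvg_cct _ (fmap_filter _ (nbhs_filter _))) => y e e0.
apply: filterS (nbhs_norm v e0) => u vu x.
by rewrite /= !tensE !mulr1; exact: vu.
Qed.

Lemma continuous_tens1_pct :
  continuous (tens^~ cts_one : pct R X -> pct R (X * X)%type).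
Proof.
move=> v; apply/(cvg_pct _ (fmap_filter _ (nbhs_filter _))) => -[x y] /=.
have FF : Filter (nbhs (v : pct R X)) := nbhs_filter _.
apply: (@cvgM _ _ _ _ (fun u : Cfun R X => u x) (cst 1)); last exact: cvg_cst.
exact: (proj1 (cvg_pct v FF) cvg_id x).
Qed.

End tensors.
Arguments cts_one {R X}.

(** * Bounds for continuous functions on a compact space *)

Section bounds.
Context (R : realType) (Z : topologicalType).

Lemma compact_real_bound (u : Z -> R) : compact [set: Z] -> continuous u ->
  exists b, forall z, `|u z| <= b.
Proof.
move=> cZ cu; have cu' : {within [set: Z], continuous u}.
  exact: continuous_subspaceT.
have /compact_bounded[M [_ Mu]] := continuous_compact cu' cZ.
by exists (M + 1) => z; apply: Mu; [rewrite ltrDl|exists z].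
Qed.

Lemma compact_Cfun_bound (f : Cfun R Z) : compact [set: Z] ->
  exists2 b : R, 0 < b & forall z, `|f z| <= b%:C%C.
Proof.
move=> cZ.
have cR : continuous (fun z => complex.Re (f z)).
  move=> z; apply: (@continuous_comp _ _ _ f); first exact: cts_fun.
  exact: Re_continuous.
have cI : continuous (fun z => complex.Im (f z)).
  move=> z; apply: (@continuous_comp _ _ _ f); first exact: cts_fun.
  exact: Im_continuous.
have [a aP] := compact_real_bound cZ cR.
have [b bP] := compact_real_bound cZ cI.
exists (2 * (`|a| + `|b| + 1)).
  by rewrite mulr_gt0// ltr_wpDl// addr_ge0.
move=> z; apply: normc_ReIm_le.
  rewrite (le_trans (aP z))// (le_trans (ler_norm _))//.
  by rewrite -addrA lerDl addr_ge0.
rewrite (le_trans (bP z))// (le_trans (ler_norm _))//.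
by rewrite [`|a| + _]addrC -addrA lerDl addr_ge0.
Qed.

End bounds.

(** * Bump functions and the support of the measure *)

Section bumps.
Context (R : realType) (X : ptopologicalType) (metX : metrizable R X).

Lemma bump (y : X) (A : set X) : nbhs y A -> exists k : X -> R,
  [/\ continuous k, forall z, 0 <= k z, 0 < k y & forall z, 0 < k z -> A z].
Proof.
have [d [d0 dC dT dN]] := metX.
have dge0 x z : 0 <= d x z.
  have := dT x z x; rewrite (_ : d x x = 0); last exact/d0.
  by rewrite [d z x]dC -mulr2n pmulrn_lge0.
move=> /dN[r r0 rA].
(* A tent of height [r] over the ball of radius [r] about [y], which lies in [A]. *)
exists (fun z => Num.max (r - d y z) 0); split.
- have cd : continuous (d y).
    move=> z; apply/cvgrPdist_lt => e e0; apply/dN; exists e => // z' /=.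
    apply: le_lt_trans; rewrite ler_norml.
    have := dT y z z'; have := dT y z' z; rewrite [d z' z]dC; lra.
  move=> z; apply: (@continuous_max R _ (fun z => r - d y z) (cst 0)).
    by apply: cvgB; [exact: cvg_cst|exact: cd].
  exact: cvg_cst.
- by move=> z; rewrite le_max lexx orbT.
- by rewrite (_ : d y y = 0) ?subr0 ?lt_max ?r0//; exact/d0.
- by move=> z; rewrite lt_max ltxx orbF subr_gt0; exact: rA.
Qed.

(** As [y] is in the support, the open set where [k] exceeds [k y / 2] has positive measure, and the
    integral is at least [k y / 2] times that measure. *)
Lemma integral_bump_gt0 (cX : compact [set: X]) (m : probability (borel X) R)
    (k : X -> R) (y : X) : measure_support m y ->
  continuous k -> (forall z, 0 <= k z) -> 0 < k y -> 0 < \int[m]_z k z.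
Proof.
move=> my ck k0 ky; pose c := k y / 2; pose B := [set z | c < k z].
have c0 : 0 < c by rewrite divr_gt0.
have oB : open B by move/continuousP : ck => /(_ _ (@open_gt R c)).
have mB : measurable (B : set (borel X)) by exact: sub_sigma_algebra.
have By : B y by rewrite /B /= /c; lra.
have mB0 : (0 < m B)%E by apply: my; split.
have ik := continuous_integrable cX m ck.
have iB : m.-integrable setT (EFin \o (\1_B : borel X -> R)).
  exact: integrable_indic.
have icB : m.-integrable setT (EFin \o (fun z : borel X => c * \1_B z)).
  exact: (integrableZl _ c iB).
apply: (@lt_le_trans _ _ (\int[m]_z (c * (\1_B : borel X -> R) z))).
  rewrite RintegralZl// mulr_gt0// /Rintegral integral_indic// setIT.
  (* [fine] sends infinite values to 0, so positivity also uses that [m B] is at most 1. *)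
  rewrite fine_gt0// mB0 /=; apply: le_lt_trans (ltry 1).
  exact: probability_le1.
apply: le_Rintegral => // z _; rewrite indicE; case: (boolP (z \in B)).
  by rewrite inE /B /= mulr1 => /ltW.
by rewrite mulr0.
Qed.

End bumps.

(** * The star product and its action on tensors *)

Section star.
Context (R : realType) (X : ptopologicalType) (cX : compact [set: X]).
Context (m : probability (borel X) R).
Implicit Types f g : Mfun R X.
Local Notation star := (star cX m).

Lemma star_kernel_continuous f g (x y : X) :
  continuous (fun z => f (x, z) * g (z, y)).
Proof.
move=> z; apply: cvgM; first exact: (@cts_fun _ _ (frow f x)).
exact: (@cts_fun _ _ (fcol g y)).
Qed.

Lemma starE f g p :
  star f g p = cintegral m (fun z => f (p.1, z) * g (z, p.2)).
Proof. by []. Qed.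

Lemma starDl f g k : star (f + g) k = star f k + star g k.
Proof.
apply/continuousEP => -[x y]; rewrite ctsDE !starE -cintegralD//.
- by congr cintegral; apply/funext => z /=; rewrite mulrDl.
- exact: star_kernel_continuous.
- exact: star_kernel_continuous.
Qed.

Lemma star0l g : star 0 g = 0.
Proof. by apply: (addrI (star 0 g)); rewrite -starDl !addr0. Qed.

(** Every column of the product stays on the line of [v], so the product lies in [R_ideal V] for
    each linear [V] containing [v]. *)
Lemma fcol_star_tens (v h : Cfun R X) g y :
  fcol (star (tens v h) g) y = cintegral m (fun z => h z * g (z, y)) *: v.
Proof.
apply/continuousEP => x.
transitivity (cintegral m (fun z => v x * (h z * g (z, y)))).
  by congr cintegral; apply/funext => z; exact: esym (mulrA _ _ _).
rewrite cintegralZ//; first exact: mulrC.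
move=> z; apply: cvgM; first exact: cts_fun.
exact: (@cts_fun _ _ (fcol g y)).
Qed.

(** Holds because [m] has total mass 1. It puts [tens v h] into every right ideal that contains
    [tens v cts_one]. *)
Lemma star_tens1 (v h : Cfun R X) :
  star (tens v cts_one) (tens cts_one h) = tens v h.
Proof.
apply/continuousEP => -[x y]; rewrite -[RHS](cintegral_cst m) starE.
by congr cintegral; apply/funext => z; rewrite !tensE /= mulr1 mul1r.
Qed.

(** Since [k] has integral 1, [f (x, y)] is the integral of [f (x, y) * k z]; the error becomes an
    average of column differences. *)
Lemma tens1_sub_star f (k : Cfun R X) (x y t : X) : cintegral m k = 1 ->
  tens (fcol f y) cts_one (x, t) - star f (tens k cts_one) (x, t) =
  cintegral m (fun z => (f (x, y) - f (x, z)) * k z).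
Proof.
move=> k1.
have ck : continuous k by exact: cts_fun.
have cf : continuous (fun z => f (x, z)) := @cts_fun _ _ (frow f x).
have cfk : continuous (fun z => f (x, z) * k z).
  by move=> z; apply: cvgM; [exact: cf|exact: ck].
transitivity (f (x, y) * cintegral m k
    + -1 * cintegral m (fun z => f (x, z) * k z)).
  rewrite tensE k1 mulN1r starE; congr (_ - cintegral m _).
  by apply/funext => z; rewrite tensE [RHS]/= mulr1.
rewrite -(cintegralZ cX m (f (x, y)) ck) -(cintegralZ cX m (-1) cfk).
have c1 : continuous (fun z => f (x, y) * k z).
  by move=> z; apply: cvgM; [exact: cvg_cst|exact: ck].
have c2 : continuous (fun z => -1 * (f (x, z) * k z)).
  by move=> z; apply: cvgM; [exact: cvg_cst|exact: cfk].
rewrite -(cintegralD cX m c1 c2).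
by congr (cintegral m _); apply/funext => z; rewrite mulN1r mulrBl.
Qed.

Lemma normc_star_le f g (a b : R) : 0 <= a ->
  (forall p, `|f p| <= a%:C%C) -> (forall p, `|g p| <= b%:C%C) ->
  forall p, `|star f g p| <= (2 * (a * b))%:C%C.
Proof.
move=> a0 fa gb [x y]; rewrite starE.
have -> : a * b = \int[m]_z (fun _ : borel X => a * b) z.
  rewrite Rintegral_cst// [Y in fine Y](_ : _ = 1%E) ?mulr1//.
  exact: probability_setT.
apply: (@normc_cintegral_le _ _ cX m _ (fun=> a * b)).
- exact: star_kernel_continuous.
- by move=> z; exact: cvg_cst.
- by move=> z; rewrite normrM rmorphM /= ler_pM.
Qed.

End star.

(** * Uniform approximation by tensors and by products *)

Section approximation.
Context (R : realType) (X : ptopologicalType) (cX : compact [set: X]).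
Context (metX : metrizable R X).
Implicit Types f : Mfun R X.

(** A tube-lemma argument: continuity at each [(x, y)] gives a box, and compactness in [x] makes the
    neighbourhood of [y] uniform. *)
Lemma fcol_near f (y : X) (e : R) : 0 < e ->
  \forall z \near y, forall x, `|f (x, y) - f (x, z)| <= e%:C%C.
Proof.
move=> e0.
have e20 : 0 < (e / 2)%:C%C :> R[i] by rewrite ltcR divr_gt0.
have /compact_near_coveringP nX := cX.
have {}nX : \forall z \near y,
    [set: X] `<=` (fun x => `|f (x, y) - f (x, z)| <= e%:C%C).
  apply: (nX _ _ (fun z x => `|f (x, y) - f (x, z)| <= e%:C%C)) => x _.
  have /cvgrPdist_lt /(_ _ e20) [[A B] /= [xA yB] AB] := @cts_fun _ _ f (x, y).
  exists (A, B) => //= -[t z] /= [At Bz].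
  have fz := AB (t, z) (conj At Bz).
  have fy := AB (t, y) (conj At (nbhs_singleton yB)).
  (* Both values are compared with [f (x, y)] at the centre of the box, at a cost of [e / 2]
     each. *)
  have -> : f (t, y) - f (t, z) =
    (f (x, y) - f (t, z)) - (f (x, y) - f (t, y)) by ring.
  rewrite (le_trans (ler_normB _ _))// (splitr e) rmorphD lerD//; exact: ltW.
by apply: filterS nX => z zP x; exact: zP.
Qed.

Lemma continuous_realC (Z : topologicalType) (k : Z -> R) : continuous k ->
  continuous (fun z => (k z)%:C%C : R[i]).
Proof. by move=> ck; apply: Complex_continuous => // z; exact: cvg_cst. Qed.

(* The functions [h i] form a partition of unity subordinate to a cover on
   whose members the columns of [f] vary by at most [e]. *)
Lemma tens_approximation f (e : R) : 0 < e ->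
  exists (s : seq X) (h : X -> Cfun R X), forall p,
    `|f p - (\sum_(i <- s) tens (fcol f i) (h i)) p| <= e%:C%C.
Proof.
move=> e0.
have /choice[k kP] : forall y, exists k : X -> R, [/\ continuous k,
    forall z, 0 <= k z, 0 < k y & forall z, 0 < k z ->
      forall x, `|f (x, y) - f (x, z)| <= e%:C%C].
  by move=> y; apply: bump => //; exact: fcol_near.
have ck i : continuous (k i) by have [] := kP i.
have k0 i z : 0 <= k i z by have [_ + _ _] := kP i; exact.
have ko i : [set: X] i -> open [set z | 0 < k i z].
  by move=> _; move/continuousP : (ck i) => /(_ _ (@open_gt R 0)).
have := cX; rewrite compact_cover => /(_ X setT _ ko)[|D _ XD].
  by move=> y _; exists y => //=; have [_ _ + _] := kP y.
pose s := finmap.enum_fset D.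
pose S z := \sum_(i <- s) k i z.
have S0 z : 0 < S z.
  have [i /= iD kiz] := XD z I.
  rewrite /S (big_rem i)//= ltr_pwDl// sumr_ge0// => j _; exact: k0.
have cS : continuous S.
  by move=> z; apply: cvg_big => [|i _]; [exact: add_continuous|exact: ck].
have ch i : continuous (fun z => (k i z / S z)%:C%C : R[i]).
  apply: continuous_realC => z; apply: cvgM; first exact: ck.
  by apply: cvgV; [rewrite gt_eqF|exact: cS].
exists s, (fun i => mkcts (ch i)) => -[x y].
have -> : (\sum_(i <- s) tens (fcol f i) (mkcts (ch i))) (x, y) =
    \sum_(i <- s) f (x, i) * (k i y / S y)%:C%C.
  by elim/big_rec2 : _ => [//|i u v _ uv]; rewrite ctsDE uv tensE.
have {1}-> : f (x, y) = \sum_(i <- s) f (x, y) * (k i y / S y)%:C%C.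
  rewrite -mulr_sumr -rmorph_sum /= -mulr_suml divff ?mulr1//.
  by rewrite gt_eqF// S0.
rewrite -sumrB (le_trans (ler_norm_sum _ _ _))//.
(* Spreading [e] over the partition of unity reduces the estimate to single summands. *)
have -> : e%:C%C = \sum_(i <- s) (e * (k i y / S y))%:C%C :> R[i].
  by rewrite -rmorph_sum /= -mulr_sumr -mulr_suml divff ?mulr1// gt_eqF// S0.
apply: ler_sum => i _.
have kS0 : 0 <= k i y / S y by rewrite divr_ge0// ltW.
rewrite -mulrBl normcMr_real// [leRHS]rmorphM.
(* Either the weight vanishes, or [y] lies in the member of the cover around [i], where columns
   differ from the one at [i] by at most [e]. *)
have [ki0|ki0] := eqVneq (k i y) 0; first by rewrite ki0 mul0r !mulr0.
apply: ler_wpM2r; first by rewrite lecR.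
rewrite distrC; have [_ _ _] := kP i; apply.
by rewrite lt_neqAle eq_sym ki0 k0.
Qed.

(** The factor [g] is a bump near [y], normalised to integral 1 and constant in the second variable,
    so [star cX m f g] averages the columns of [f] close to the one at [y]. *)
Lemma tens1_approximation (m : probability (borel X) R) f (y : X) (e : R) :
  measure_support m y -> 0 < e ->
  exists g, forall p, `|tens (fcol f y) cts_one p - star cX m f g p| <= e%:C%C.
Proof.
move=> my e0; have e20 : 0 < e / 2 by rewrite divr_gt0.
have [k [ck k0 ky kf]] := bump metX (fcol_near f y e20).
pose c := \int[m]_z k z.
have c0 : 0 < c by exact: integral_bump_gt0 ky.
have ck' : continuous (fun z => c^-1 * k z).
  by move=> z; apply: cvgM; [exact: cvg_cst|exact: ck].
have ik' : \int[m]_z (c^-1 * k z) = 1.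
  rewrite RintegralZl ?mulVf ?gt_eqF//; exact: continuous_integrable.
have cK := continuous_realC ck'.
exists (tens (mkcts cK) cts_one) => -[x t].
rewrite tens1_sub_star//; last first.
  by rewrite [LHS](cintegral_realC m ck') ik'.
(* The tolerance [e / 2] in the choice of [k] offsets the factor 2 of [normc_cintegral_le]. *)
have eE : 2 * \int[m]_z (e / 2 * (c^-1 * k z)) = e.
  rewrite (RintegralZl _ measurableT (continuous_integrable cX m ck')) ik'.
  by rewrite mulr1 mulrC divfK.
rewrite -[e in leRHS]eE; apply: (normc_cintegral_le cX).
- move=> z; apply: cvgM; last exact: cK.
  by apply: cvgB; [exact: cvg_cst|exact: (@cts_fun _ _ (frow f x))].
- by move=> z; apply: cvgM; [exact: cvg_cst|exact: ck'].
move=> z; have K0 : 0 <= c^-1 * k z by rewrite mulr_ge0// invr_ge0 ltW.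
rewrite normcMr_real// [leRHS]rmorphM.
have [kz0|kz0] := eqVneq (k z) 0; first by rewrite kz0 !mulr0.
apply: ler_wpM2r; first by rewrite lecR.
by apply: kf; rewrite lt_neqAle eq_sym kz0 k0.
Qed.

End approximation.

(** * Linear subspaces and the adjunction of a vector *)

Section linear_subspaces.
Context (K : numFieldType) (E : lmodType K).
Implicit Types V W : set E.

Lemma linear_subspaceZ V a v : linear_subspace V -> V v -> V (a *: v).
Proof. by move=> [V0 VL] Vv; rewrite -[a *: v]addr0; exact: VL. Qed.

Lemma linear_subspaceD V u v : linear_subspace V -> V u -> V v -> V (u + v).
Proof. by move=> [V0 VL] Vu Vv; rewrite -[u]scale1r; exact: VL. Qed.

Lemma linear_subspaceB V u v : linear_subspace V -> V u -> V v -> V (u - v).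
Proof.
move=> VL Vu Vv; apply: linear_subspaceD => //; rewrite -scaleN1r.
exact: linear_subspaceZ.
Qed.

Lemma linear_subspace_sum V (I : Type) (s : seq I) (F : I -> E) :
  linear_subspace V -> (forall i, V (F i)) -> V (\sum_(i <- s) F i).
Proof.
move=> VL VF; apply: (big_ind V) => //; first by have [] := VL.
by move=> u v; exact: linear_subspaceD.
Qed.

Lemma linear_subspace_cancel V a v :
  linear_subspace V -> a != 0 -> V (a *: v) -> V v.
Proof.
move=> VL a0 Vav; rewrite -[v]scale1r -(mulVf a0) -scalerA.
exact: linear_subspaceZ.
Qed.

Lemma linear_subspace_neq0 V :
  linear_subspace V -> V <> [set 0] -> exists2 v, V v & v != 0.
Proof.
move=> [V0 _] VN0; apply: contrapT => noV; apply: VN0.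
apply/seteqP; split=> [v Vv|_ ->//] /=.
by apply: contrapT => /eqP v0; apply: noV; exists v.
Qed.

(** The sum of [V] and the line of [w], in the form that matches [one_codimensional]. *)
Definition add_line V w : set E := [set u | exists a : K, V (u - a *: w)].

Lemma add_line_subspace V w :
  linear_subspace V -> linear_subspace (add_line V w).
Proof.
move=> VL; split; first by exists 0; rewrite scale0r subr0; have [] := VL.
move=> c u v [a Va] [b Vb]; exists (c * a + b).
rewrite scalerDl -scalerA opprD addrACA -scalerBr; have [_ ] := VL; exact.
Qed.

Lemma sub_add_line V w : V `<=` add_line V w.
Proof. by move=> v Vv; exists 0; rewrite scale0r subr0. Qed.

Lemma mem_add_line V w : linear_subspace V -> add_line V w w.
Proof. by move=> [V0 _]; exists 1; rewrite scale1r subrr. Qed.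

Lemma line_subspace0 : linear_subspace [set 0 : E].
Proof. by split=> // a _ _ -> ->; rewrite /= scaler0 addr0. Qed.

Lemma add_line0 w : add_line [set 0] w = [set a *: w | a in [set: K]].
Proof.
apply/seteqP; split=> [u [a /= /eqP]|_ [a _ <-]].
  by rewrite subr_eq0 => /eqP ->; exists a.
by exists a; rewrite /= subrr.
Qed.

End linear_subspaces.

(** * Closed subspaces, lines and closed hyperplanes *)

Section closed_subspaces.
Context (R : realType).

(** The hypothesis says that the intervals of radius [e * c] about [r e] meet pairwise; the supremum
    of their left endpoints then lies in all of them. This yields limits of coefficients without
    sequences. *)
Lemma sup_interpolation (r : R -> R) (c : R) :
  (forall e e', 0 < e -> 0 < e' -> r e - e * c <= r e' + e' * c) ->
  exists t, forall e, 0 < e -> `|t - r e| <= e * c.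
Proof.
move=> rc; pose A := [set r e - e * c | e in [set e | 0 < e]].
have A0 : A !=set0 by exists (r 1 - 1 * c), 1 => //=.
have ubA e : 0 < e -> ubound A (r e + e * c).
  by move=> e0 _ [e' e'0 <-]; exact: rc.
exists (sup A) => e e0; rewrite ler_distl; apply/andP; split.
  apply: sup_upper_bound; last by exists e.
  by split=> //; exists (r 1 + 1 * c); exact: ubA.
by apply: ge_sup => //; exact: ubA.
Qed.

Lemma normc_is_real (z : R[i]) : exists2 r : R, 0 <= r & `|z| = r%:C%C.
Proof.
case: z => x y; exists (Num.sqrt (x ^+ 2 + y ^+ 2)).
  by rewrite sqrtr_ge0.
by rewrite normc_def.
Qed.

Context (X : topologicalType) (cX : compact [set: X]).
Implicit Types (V : set (Cfun R X)) (u v w : Cfun R X).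

Lemma unif_closed_dist V w : unif_closed V -> ~ V w ->
  exists2 d : R, 0 < d & forall v, V v -> ~ forall z, `|w z - v z| <= d%:C%C.
Proof.
move=> cV nVw; apply: contrapT => nd; apply: nVw; apply: cV => d d0.
apply: contrapT => nv; apply: nd; exists d => // v Vv wv.
by apply: nv; exists v.
Qed.

(** If [a] had larger modulus, dividing by [a] would put a multiple of [v] within [d] of [w]. In
    effect, the coefficient of [w] is a bounded functional on [add_line V w]. *)
Lemma coef_le_dist V w (d : R) : linear_subspace V -> 0 < d ->
  (forall v, V v -> ~ forall z, `|w z - v z| <= d%:C%C) ->
  forall (a : R[i]) v (e : R), V v -> 0 < e ->
    (forall z, `|a * w z - v z| <= e%:C%C) -> `|a| <= (e / d)%:C%C.
Proof.
move=> VL d0 wV a v e Vv e0 awv.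
have [->|a0] := eqVneq a 0; first by rewrite normr0 lecR divr_ge0// ltW.
have [r r0 ar] := normc_is_real a; rewrite ar lecR leNgt; apply/negP => der.
apply: (wV (a^-1 *: v)); first exact: linear_subspaceZ.
move=> z; have -> : w z - (a^-1 *: v) z = a^-1 * (a * w z - v z).
  by rewrite mulrBr mulKf.
have rp : 0 < r by apply: lt_trans der; rewrite divr_gt0.
rewrite normrM normfV ar -(ler_pM2l (x := r%:C%C)) ?ltcR//.
rewrite mulVKf; last by rewrite -ar normr_eq0.
apply: (le_trans (awv z)); rewrite -rmorphM lecR /= -ler_pdivrMr//.
exact: ltW.
Qed.

(** If [u] is a uniform limit of elements [p + a *: w], the coefficients [a] are Cauchy by
    [coef_le_dist]; with their limit [b], the function [u - b *: w] is a uniform limit of elements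
    of [V]. *)
Lemma unif_closed_add_line V w : linear_subspace V -> unif_closed V -> ~ V w ->
  unif_closed (add_line V w).
Proof.
move=> VL cV nVw u ulim.
have [d d0 wV] := unif_closed_dist cV nVw.
have /choice[a aP] : forall e : R, exists a : R[i], 0 < e ->
    exists2 p, V p & forall z, `|u z - a * w z - p z| <= e%:C%C.
  move=> e; have [e0|//] := ltP 0 e; last by exists 0.
  have [g [a Vg] ug] := ulim _ e0; exists a => _.
  exists (g - a *: w) => // z; apply: le_trans (ug z).
  rewrite (_ : (g - a *: w) z = g z - a * w z)//.
  by rewrite opprB addrA subrK.
have aa e e' : 0 < e -> 0 < e' -> `|a e' - a e| <= ((e + e') / d)%:C%C.
  move=> e0 e'0; have [p Vp up] := aP e e0; have [p' Vp' up'] := aP e' e'0.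
  apply: (coef_le_dist VL d0 wV (v := p - p')).
  - exact: linear_subspaceB.
  - by rewrite addr_gt0.
  move=> z; rewrite (_ : (p - p') z = p z - p' z)//.
  have -> : (a e' - a e) * w z - (p z - p' z) =
    (u z - a e * w z - p z) - (u z - a e' * w z - p' z) by ring.
  by rewrite (le_trans (ler_normB _ _))// rmorphD lerD.
(* The limit is found separately for real and imaginary parts, each a real family with error linear
   in [e]. *)
have [s sP] : exists s, forall e, 0 < e -> `|s - complex.Re (a e)| <= e * d^-1.
  apply: sup_interpolation => e e' e0 e'0.
  have [+ _] := normc_le_ReIm (aa e e' e0 e'0).
  by rewrite raddfB /= mulrDl ler_norml => /andP[]; lra.
have [t tP] : exists t, forall e, 0 < e -> `|t - complex.Im (a e)| <= e * d^-1.
  apply: sup_interpolation => e e' e0 e'0.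
  have [_ +] := normc_le_ReIm (aa e e' e0 e'0).
  by rewrite raddfB /= mulrDl ler_norml => /andP[]; lra.
pose b : R[i] := Complex s t.
have ba e : 0 < e -> `|b - a e| <= (2 * (e * d^-1))%:C%C.
  by move=> e0; apply: normc_ReIm_le; rewrite raddfB /=; [exact: sP|exact: tP].
have [B B0 wB] := compact_Cfun_bound w cX.
(* [e'] is chosen so that the error [e'] for [p] and the error [2 * (e' / d) * B] for replacing
   [a e'] by [b] add up to [e]. *)
exists b; apply: cV => e e0; pose e' := e / (1 + 2 * d^-1 * B).
have D0 : 0 < 1 + 2 * d^-1 * B.
  by rewrite ltr_wpDr ?mulr_ge0 ?invr_ge0 ?(ltW d0) ?(ltW B0).
have e'0 : 0 < e' by rewrite divr_gt0.
have [p Vp up] := aP e' e'0; exists p => // z.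
rewrite (_ : (u - b *: w) z = u z - b * w z)//.
have -> : u z - b * w z - p z =
  (u z - a e' * w z - p z) - (b - a e') * w z by ring.
have -> : e = e' + 2 * (e' * d^-1) * B.
  by rewrite -[LHS](divfK (lt0r_neq0 D0)) -/e'; ring.
rewrite (le_trans (ler_normB _ _))// rmorphD lerD// normrM rmorphM.
by rewrite ler_pM// ba.
Qed.

Lemma norm_closed_add_line V w : norm_closed_subspace V -> ~ V w ->
  norm_closed_subspace (add_line V w).
Proof.
move=> [VL /norm_closedP cV] nVw; split; first exact: add_line_subspace.
by apply/norm_closedP; exact: unif_closed_add_line.
Qed.

Lemma norm_closed_subspace0 : norm_closed_subspace [set 0 : Cfun R X].
Proof.
split; first exact: line_subspace0.
apply/norm_closedP => f f0; apply/continuousEP => z; apply/eqP.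
have [r r0 fr] := normc_is_real (f z).
rewrite -normr_eq0 fr (_ : r = 0)//; apply/eqP; rewrite eq_le r0 andbT leNgt.
apply/negP => rp; have r20 : 0 < r / 2 by rewrite divr_gt0.
have [_ -> /(_ z)] := f0 _ r20.
rewrite (_ : (0 : Cfun R X) z = 0)// subr0 fr lecR; lra.
Qed.

(** Every line is closed, being the zero subspace enlarged by one vector, and every nonzero subspace
    contains a line. *)
Lemma minimal_norm_closed_subspace :
  [set V | one_dimensional V] =
  [set V | minimal_nonzero (@norm_closed_subspace R X) V].
Proof.
have ncs v : v != 0 ->
    norm_closed_subspace [set a *: v | a in [set: R[i]]].
  move=> /eqP v0; rewrite -add_line0.
  by apply: norm_closed_add_line; [exact: norm_closed_subspace0|].
have line v : [set a *: v | a in [set: R[i]]] v by exists 1; rewrite ?scale1r.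
apply/seteqP; split=> V.
- move=> [v v0 ->]; split; first exact: ncs.
    by move=> V0; have := line v; rewrite V0 => /eqP; rewrite (negbTE v0).
  (* A nonzero [J] inside the line contains a nonzero multiple of [v], hence [v] itself. *)
  move=> J [JL _] /(linear_subspace_neq0 JL)[j Jj j0] JV.
  apply/seteqP; split=> // _ [b _ <-]; apply: linear_subspaceZ => //.
  have [a _ aj] := JV _ Jj; apply: (linear_subspace_cancel (a := a)) => //.
    by apply: contraNneq j0 => a0; rewrite -aj a0 scale0r.
  by rewrite aj.
- move=> [[VL Vc] /(linear_subspace_neq0 VL)[v Vv v0] Vmin].
  exists v => //; apply/esym/Vmin; first exact: ncs.
    by move=> V0; have := line v; rewrite V0 => /eqP; rewrite (negbTE v0).
  by move=> _ [a _ <-]; exact: linear_subspaceZ.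
Qed.

Lemma maximal_norm_closed_subspace :
  [set V | norm_closed_subspace V /\ one_codimensional V] =
  [set V | maximal_proper (@norm_closed_subspace R X) V].
Proof.
apply/seteqP; split=> V.
- move=> [Vc [VL [w nVw Vw]]]; split=> //.
    by move=> VT; apply: nVw; rewrite VT.
  move=> J [JL _] JT VJ; apply/seteqP; split=> // u Ju.
  (* If some [u] in [J] has a nonzero coefficient at [w], then [w] is in [J] and [J] is
     everything. *)
  have [a Va] := Vw u; have [a0|a0] := eqVneq a 0.
    by move: Va; rewrite a0 scale0r subr0.
  exfalso; apply: JT; apply/seteqP; split=> // t _.
  have Jw : J w.
    apply: (linear_subspace_cancel (a := a)) => //.
    by rewrite -[_ *: w](subKr u); apply: linear_subspaceB => //; exact: VJ.
  have [b Vb] := Vw t; rewrite -(subrK (b *: w) t).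
  by apply: linear_subspaceD; [|exact: VJ|exact: linear_subspaceZ].
- move=> [Vc VT Vmax]; split=> //; split; first by case: Vc.
  have [w nVw] : exists w, ~ V w.
    apply: contrapT => nw; apply: VT; apply/seteqP; split=> // w _.
    by apply: contrapT => nVw; apply: nw; exists w.
  (* A [u] outside [add_line V w] would make that subspace proper, so by maximality it would equal
     [V] and [V] would contain [w]. *)
  exists w => // u; apply: contrapT => nu; apply: (nVw).
  rewrite -(Vmax (add_line V w)).
  - by apply: mem_add_line; case: Vc.
  - exact: norm_closed_add_line.
  - by move=> lT; apply: nu; have : [set: Cfun R X] u by []; rewrite -lT.
  - exact: sub_add_line.
Qed.

End closed_subspaces.

(** * Transport of minimal and maximal members *)

Section order_isomorphisms.
Context (E E' : Type) (phi : set E -> set E').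

(** Common form of [minimal_nonzero], with inclusion and [[set 0]] as [b], and of [maximal_proper],
    with reversed inclusion and the full set as [b]. *)
Definition extremal (T : Type) (r : set T -> set T -> Prop)
    (P : set T -> Prop) (b I : set T) :=
  [/\ P I, I <> b & forall J, P J -> J <> b -> r J I -> J = I].

(** Injectivity on all sets, [b] included, makes differing from [b] equivalent to having an image
    that differs from [phi b]. *)
Lemma extremal_bij r r' (P : set E -> Prop) (Q : set E' -> Prop) b :
  injective phi -> (forall V W, r' (phi V) (phi W) <-> r V W) ->
  set_bij [set V | P V] [set I | Q I] phi ->
  set_bij [set V | extremal r P b V] [set I | extremal r' Q (phi b) I] phi.
Proof.
move=> phiI phir [phiP _ phiQ]; split; last 1 first.
- move=> I [QI Ib Imax]; have [V PV VI] := phiQ _ QI; exists V => //=.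
  split=> //; first by move=> Vb; apply: Ib; rewrite -VI Vb.
  move=> W PW Wb rWV; apply: (phiI); rewrite VI; apply: Imax.
  + exact: phiP.
  + by move/phiI.
  + by rewrite -VI; apply/phir.
- move=> V [PV Vb Vmax]; split; [exact: phiP|by move/phiI|].
  move=> J QJ Jb rJ; have [W PW WJ] := phiQ _ QJ.
  rewrite -WJ (Vmax W)//; first by move=> Wb; apply: Jb; rewrite -WJ Wb.
  by apply/phir; rewrite WJ.
- by move=> V W _ _; exact: phiI.
Qed.

End order_isomorphisms.

Section minimal_maximal.
Context (E E' : zmodType) (phi : set E -> set E').
Context (P : set E -> Prop) (Q : set E' -> Prop).
Hypothesis phiS : forall V W, phi V `<=` phi W <-> V `<=` W.
Hypothesis phi_bij : set_bij [set V | P V] [set I | Q I] phi.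

Let phi_inj : injective phi.
Proof.
move=> V W VW; have sVW : phi V `<=` phi W by rewrite VW.
have sWV : phi W `<=` phi V by rewrite VW.
by apply/seteqP; split; apply/phiS.
Qed.

Lemma minimal_bij : phi [set 0] = [set 0] ->
  set_bij [set V | minimal_nonzero P V] [set I | minimal_nonzero Q I] phi.
Proof.
move=> phi0.
have := @extremal_bij _ _ phi subset subset P Q [set 0] phi_inj phiS phi_bij.
by rewrite phi0.
Qed.

Lemma maximal_bij : phi [set: E] = [set: E'] ->
  set_bij [set V | maximal_proper P V] [set I | maximal_proper Q I] phi.
Proof.
move=> phiT.
have := @extremal_bij _ _ phi (fun J I => I `<=` J) (fun J I => I `<=` J) P Q
  [set: E] phi_inj (fun V W => phiS W V) phi_bij.
by rewrite phiT.
Qed.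

End minimal_maximal.

(** * The correspondence for right ideals *)

Section right_ideals.
Context (R : realType) (X : ptopologicalType).
Implicit Types (V W : set (Cfun R X)) (I : set (Mfun R X)).

(** All columns of [tens v cts_one] equal [v], so [V] can be read off from [R_ideal V]; [point]
    provides a column. *)
Lemma R_ideal_tens1 V v : R_ideal V (tens v cts_one) <-> V v.
Proof.
split=> [/(_ point)|Vv y]; first by rewrite fcol_tens1.
by rewrite fcol_tens1.
Qed.

Lemma R_idealS V W : R_ideal V `<=` R_ideal W <-> V `<=` W.
Proof.
split=> VW; last by move=> f Vf y; apply: VW.
by move=> v /R_ideal_tens1/VW/R_ideal_tens1.
Qed.

Lemma R_ideal0 : R_ideal [set 0 : Cfun R X] = [set 0].
Proof.
apply/seteqP; split=> [f f0|_ -> y]; last exact/continuousEP.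
by apply/continuousEP => -[x y]; have /continuousEP/(_ x) := f0 y.
Qed.

Lemma R_idealT : R_ideal [set: Cfun R X] = [set: Mfun R X].
Proof. by apply/seteqP; split. Qed.

Lemma R_ideal_linear V : linear_subspace V -> linear_subspace (R_ideal V).
Proof.
move=> [V0 VL]; split=> [y|a f g Vf Vg y].
  by rewrite (_ : fcol 0 y = 0)//; exact/continuousEP.
rewrite (_ : fcol _ y = a *: fcol f y + fcol g y); first exact: VL.
exact/continuousEP.
Qed.

(** The inverse of [R_ideal] on closed right ideals. *)
Definition constant_columns I : set (Cfun R X) :=
  [set v | I (tens v cts_one)].

Lemma constant_columns_linear I :
  linear_subspace I -> linear_subspace (constant_columns I).
Proof.
move=> [I0 IL]; split=> [|a u v Iu Iv]; rewrite /constant_columns /=.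
  rewrite (_ : tens 0 _ = 0)//; apply/continuousEP => p.
  by rewrite tensE mul0r.
rewrite (_ : tens _ _ = a *: tens u cts_one + tens v cts_one); first exact: IL.
apply/continuousEP => p; rewrite ctsDE tensE mulr1.
by congr (_ * _ + _); rewrite tensE mulr1.
Qed.

Lemma constant_columns_closed_cct I : closed (I : set (cct R X)) ->
  closed (constant_columns I : set (norm_topology R X)).
Proof.
refine (@preimage_closed (norm_topology R X) (cct R X)
  (fun v : Cfun R X => tens v cts_one) I _).
by move=> v _; exact: continuous_tens1_cct.
Qed.

Lemma constant_columns_closed_pct I : closed (I : set (pct R (X * X)%type)) ->
  closed (constant_columns I : set (pct R X)).
Proof.
refine (@preimage_closed (pct R X) (pct R (X * X)%type)
  (fun v : Cfun R X => tens v cts_one) I _).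
by move=> v _; exact: continuous_tens1_pct.
Qed.

Context (cX : compact [set: X]) (metX : metrizable R X).
Context (m : probability (borel X) R).

(** With [f] replaced by a sum of tensors built on its own columns, each column of the product is a
    combination of elements of [V]; uniform closedness passes to the limit. *)
Lemma R_ideal_right_ideal V : linear_subspace V -> unif_closed V ->
  right_ideal cX m (R_ideal V).
Proof.
move=> VL cV; split; first exact: R_ideal_linear.
move=> f g Vf y; apply: cV => e e0.
have cXX : compact [set: X * X] by rewrite -setXTT; exact: compact_setX.
have [b b0 gb] := compact_Cfun_bound g cXX.
(* The tolerance for which [normc_star_le] gives exactly the error [e]. *)
have a0 : 0 < e / (2 * b) by rewrite divr_gt0// mulr_gt0.
have [s [h fh]] := tens_approximation cX metX f a0.
pose f' := \sum_(i <- s) tens (fcol f i) (h i).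
exists (fcol (star cX m f' g) y).
  rewrite /f'; elim/big_rec : _ => [|i u _ Vu].
    by rewrite star0l (_ : fcol 0 y = 0); [case: VL|exact/continuousEP].
  rewrite starDl (_ : fcol _ y = fcol (star cX m (tens (fcol f i) (h i)) g) y
    + fcol (star cX m u g) y); last exact/continuousEP.
  apply: linear_subspaceD => //; rewrite fcol_star_tens.
  exact: linear_subspaceZ.
move=> x.
have -> : fcol (star cX m f g) y x - fcol (star cX m f' g) y x =
    star cX m (f - f') g (x, y).
  have E : star cX m f g = star cX m (f - f') g + star cX m f' g.
    by rewrite -starDl subrK.
  have -> : fcol (star cX m f g) y x = star cX m f g (x, y) by [].
  by rewrite E ctsDE addrK.
have -> : e = 2 * (e / (2 * b) * b) by field; rewrite gt_eqF.
by apply: normc_star_le => //; exact: ltW.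
Qed.

Hypothesis suppm : measure_support m = [set: X].

(** By [tens1_approximation], the column extended constantly is a uniform limit of right multiples
    of [f]; full support makes this available at every [y]. *)
Lemma right_ideal_fcol I f y : right_ideal cX m I -> unif_closed I ->
  I f -> constant_columns I (fcol f y).
Proof.
move=> [_ IR] cI If; apply: cI => e e0.
have my : measure_support m y by rewrite suppm.
have [g fg] := tens1_approximation cX metX f my e0.
by exists (star cX m f g) => //; exact: IR.
Qed.

Lemma R_ideal_constant_columns I : right_ideal cX m I -> unif_closed I ->
  R_ideal (constant_columns I) = I.
Proof.
move=> IR cI; apply/seteqP; split=> f; last first.
  by move=> If y; exact: right_ideal_fcol.
move=> If; apply: cI => e e0.
have [s [h fh]] := tens_approximation cX metX f e0.
exists (\sum_(i <- s) tens (fcol f i) (h i)) => //.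
have [IL Istar] := IR; apply: linear_subspace_sum => // i.
(* Each tensor factors through [tens (fcol f i) cts_one], which is in [I] by the assumption on
   [f]. *)
by rewrite -(star_tens1 cX m); apply: Istar; exact: If.
Qed.

Lemma R_ideal_bij_cc : set_bij [set V | @norm_closed_subspace R X V]
  [set I | cc_closed_right_ideal cX m I] (@R_ideal R X).
Proof.
split.
- move=> V [VL cV]; split; last exact: R_ideal_closed_cct.
  by apply: R_ideal_right_ideal => //; exact/norm_closedP.
- by move=> V W _ _ VW; apply/seteqP; split; apply/R_idealS; rewrite VW.
- move=> I [IR cI]; exists (constant_columns I).
    split; last exact: constant_columns_closed_cct.
    by apply: constant_columns_linear; case: IR.
  by apply: R_ideal_constant_columns => //; exact: cct_closed_unif.
Qed.

(** A pc-closed set is closed in the finer topologies, so the same inverse works; what is new is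
    that [R_ideal] and [constant_columns] preserve pc-closedness. *)
Lemma R_ideal_bij_pc : set_bij [set V | @pc_closed_subspace R X V]
  [set I | pc_closed_right_ideal cX m I] (@R_ideal R X).
Proof.
split.
- move=> V [VL cV]; split; last exact: R_ideal_closed_pct.
  apply: R_ideal_right_ideal => //; apply/norm_closedP.
  exact: pct_closed_norm.
- by move=> V W _ _ VW; apply/seteqP; split; apply/R_idealS; rewrite VW.
- move=> I [IR cI]; exists (constant_columns I).
    split; last exact: constant_columns_closed_pct.
    by apply: constant_columns_linear; case: IR.
  apply: R_ideal_constant_columns => //; apply: cct_closed_unif.
  exact: pct_closed_cct.
Qed.

End right_ideals.

(** * Transposition and left ideals *)

Section transposition.
Context (R : realType) (X : ptopologicalType).
Implicit Types (V : set (Cfun R X)) (I J : set (Mfun R X)) (f g : Mfun R X).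

Lemma transpose_subproof f : continuous (fun p : X * X => f (p.2, p.1)).
Proof.
move=> p; apply: (@continuous_comp _ _ _ (fun p : X * X => (p.2, p.1)) f).
  by apply: cvg_pair; [exact: cvg_snd|exact: cvg_fst].
exact: cts_fun.
Qed.

(** Unlike in the involution of the algebra, no conjugate is taken, so that rows in [V] become
    columns in the same [V]. *)
Definition transpose f : Mfun R X := mkcts (@transpose_subproof f).

Lemma transposeE f x y : transpose f (x, y) = f (y, x).
Proof. by []. Qed.

Lemma transposeK : involutive transpose.
Proof. by move=> f; apply/continuousEP => -[x y]. Qed.

Lemma transpose_preK I : transpose @^-1` (transpose @^-1` I) = I.
Proof. by apply/seteqP; split=> f; rewrite /= transposeK. Qed.

Lemma transpose_preS I J :
  transpose @^-1` I `<=` transpose @^-1` J <-> I `<=` J.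
Proof.
split=> IJ; last by move=> f; exact: IJ.
by move=> f If; rewrite -[f]transposeK; apply: IJ; rewrite /= transposeK.
Qed.

Lemma transpose0 : transpose 0 = 0.
Proof. exact/continuousEP. Qed.

Lemma transpose_pre0 : transpose @^-1` [set 0] = [set 0].
Proof.
apply/seteqP; split=> f /=; last by move=> ->; exact: transpose0.
by move=> f0; rewrite -[f]transposeK f0 transpose0.
Qed.

Lemma L_ideal_transpose V : L_ideal V = transpose @^-1` R_ideal V.
Proof.
have frowE f x : frow f x = fcol (transpose f) x by exact/continuousEP.
by apply/seteqP; split=> f Vf x; [rewrite -frowE|rewrite frowE].
Qed.

Lemma transpose_linear I :
  linear_subspace I -> linear_subspace (transpose @^-1` I).
Proof.
move=> [I0 IL]; split=> [|a f g If Ig] /=; first by rewrite transpose0.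
rewrite (_ : transpose _ = a *: transpose f + transpose g); first exact: IL.
exact/continuousEP.
Qed.

Lemma transpose_closed_rct I : closed (I : set (cct R X)) ->
  closed (transpose @^-1` I : set (rct R X)).
Proof.
apply: (@preimage_closed (rct R X) (cct R X) transpose) => f _.
apply/(cvg_cct _ (fmap_filter _ (nbhs_filter _))) => y e e0.
have FF : Filter (nbhs (f : rct R X)) := nbhs_filter _.
exact: (proj1 (cvg_rct f FF) cvg_id y e e0).
Qed.

Lemma transpose_closed_cct I : closed (I : set (rct R X)) ->
  closed (transpose @^-1` I : set (cct R X)).
Proof.
apply: (@preimage_closed (cct R X) (rct R X) transpose) => f _.
apply/(cvg_rct _ (fmap_filter _ (nbhs_filter _))) => y e e0.
exact: nbhs_cct.
Qed.

Lemma transpose_closed_pct I : closed (I : set (pct R (X * X)%type)) ->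
  closed (transpose @^-1` I : set (pct R (X * X)%type)).
Proof.
apply: (@preimage_closed (pct R (X * X)%type) (pct R (X * X)%type) transpose).
move=> f _; apply/(cvg_pct _ (fmap_filter _ (nbhs_filter _))) => -[x y].
have FF : Filter (nbhs (f : pct R (X * X)%type)) := nbhs_filter _.
exact: (proj1 (cvg_pct f FF) cvg_id (y, x)).
Qed.

Lemma transpose_bij (P Q : set (Mfun R X) -> Prop) :
  (forall I, P I -> Q (transpose @^-1` I)) ->
  (forall I, Q I -> P (transpose @^-1` I)) ->
  set_bij [set I | P I] [set I | Q I] (fun I => transpose @^-1` I).
Proof.
move=> PQ QP; split=> //.
- by move=> I J _ _ IJ; rewrite -[I]transpose_preK IJ transpose_preK.
- move=> I QI; exists (transpose @^-1` I); first exact: QP.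
  exact: transpose_preK.
Qed.

Context (cX : compact [set: X]) (m : probability (borel X) R).

(** Commutativity of the complex product under the integral makes transposition an
    anti-automorphism, which exchanges right and left ideals. *)
Lemma transpose_star f g :
  transpose (star cX m f g) = star cX m (transpose g) (transpose f).
Proof.
apply/continuousEP => -[x y]; rewrite transposeE !starE.
by congr (cintegral m _); apply/funext => z; rewrite mulrC.
Qed.

Lemma transpose_left_ideal I :
  right_ideal cX m I -> left_ideal cX m (transpose @^-1` I).
Proof.
move=> [IL IR]; split=> [|f g If /=]; first exact: transpose_linear.
by rewrite transpose_star; exact: IR.
Qed.

Lemma transpose_right_ideal I :
  left_ideal cX m I -> right_ideal cX m (transpose @^-1` I).
Proof.
move=> [IL IR]; split=> [|f g If /=]; first exact: transpose_linear.
by rewrite transpose_star; exact: IR.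
Qed.

Lemma transpose_bij_cc_rc : set_bij [set I | cc_closed_right_ideal cX m I]
  [set I | rc_closed_left_ideal cX m I] (fun I => transpose @^-1` I).
Proof.
apply: transpose_bij => I [II cI]; split.
- exact: transpose_left_ideal.
- exact: transpose_closed_rct.
- exact: transpose_right_ideal.
- exact: transpose_closed_cct.
Qed.

Lemma transpose_bij_pc : set_bij [set I | pc_closed_right_ideal cX m I]
  [set I | pc_closed_left_ideal cX m I] (fun I => transpose @^-1` I).
Proof.
apply: transpose_bij => I [II cI]; split.
- exact: transpose_left_ideal.
- exact: transpose_closed_pct.
- exact: transpose_right_ideal.
- exact: transpose_closed_pct.
Qed.

Lemma L_ideal_bij (P : set (Cfun R X) -> Prop) (Q Q' : set (Mfun R X) -> Prop) :
  set_bij [set V | P V] [set I | Q I] (@R_ideal R X) ->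
  set_bij [set I | Q I] [set I | Q' I] (fun I => transpose @^-1` I) ->
  set_bij [set V | P V] [set I | Q' I] (@L_ideal R X).
Proof.
move=> PQ QQ'; rewrite (_ : @L_ideal R X =
  (fun I => transpose @^-1` I) \o @R_ideal R X).
  exact: set_bij_comp PQ QQ'.
by apply/funext => V; exact: L_ideal_transpose.
Qed.

End transposition.

Theorem corollary5p3 (R : realType) (X : ptopologicalType)
    (cX : compact [set: X]) (metX : metrizable R X)
    (m : probability (borel X) R) (suppm : measure_support m = [set: X]) :
  [/\ set_bij [set V | @norm_closed_subspace R X V]
        [set I | cc_closed_right_ideal cX m I] (@R_ideal R X),
      set_bij [set V | @norm_closed_subspace R X V]
        [set I | rc_closed_left_ideal cX m I] (@L_ideal R X),
      set_bij [set V | @pc_closed_subspace R X V]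
        [set I | pc_closed_right_ideal cX m I] (@R_ideal R X) &
      set_bij [set V | @pc_closed_subspace R X V]
        [set I | pc_closed_left_ideal cX m I] (@L_ideal R X)] /\
  [/\ set_bij [set V : set (Cfun R X) | one_dimensional V]
        [set I | minimal_nonzero (cc_closed_right_ideal cX m) I]
        (@R_ideal R X),
      set_bij [set V : set (Cfun R X) | one_dimensional V]
        [set I | minimal_nonzero (rc_closed_left_ideal cX m) I]
        (@L_ideal R X),
      set_bij
        [set V : set (Cfun R X) | norm_closed_subspace V /\ one_codimensional V]
        [set I | maximal_proper (cc_closed_right_ideal cX m) I]
        (@R_ideal R X) &
      set_bij
        [set V : set (Cfun R X) | norm_closed_subspace V /\ one_codimensional V]
        [set I | maximal_proper (rc_closed_left_ideal cX m) I]
        (@L_ideal R X)].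
Proof.
have Rcc := R_ideal_bij_cc cX metX suppm.
have Rpc := R_ideal_bij_pc cX metX suppm.
have Tcc := transpose_bij_cc_rc cX m.
(* The correspondences preserve inclusion, the zero set and the full set, hence minimal and maximal
   members. *)
have Rmin := minimal_bij (@R_idealS R X) Rcc (@R_ideal0 R X).
have Rmax := maximal_bij (@R_idealS R X) Rcc (@R_idealT R X).
have Tmin := minimal_bij (@transpose_preS R X) Tcc (@transpose_pre0 R X).
have Tmax := maximal_bij (@transpose_preS R X) Tcc (preimage_setT _).
(* Among subspaces, the minimal and maximal members are the lines and the closed hyperplanes. *)
rewrite -(minimal_norm_closed_subspace R cX) in Rmin.
rewrite -(maximal_norm_closed_subspace R cX) in Rmax.
split; split=> //.
- exact: L_ideal_bij Rcc Tcc.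
- exact: L_ideal_bij Rpc (transpose_bij_pc cX m).
- exact: L_ideal_bij Rmin Tmin.
- exact: L_ideal_bij Rmax Tmax.
Qed.
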